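(* Let $X$ be a compact metric space and $f_{0,\infty}=\{f_n\}_{n=0}^\infty$ a sequence of continuous self-maps of $X$. Then $(X,f_{0,\infty})$ is cofinitely sensitive if and only if $(\mathcal{M}(X),\hat f_{0,\infty})$ is cofinitely sensitive.
   Context: Let $(X,d)$ be a compact metric space. A non-autonomous dynamical system $(X,f_{0,\infty})$ is given by a sequence $f_{0,\infty}=\{f_n\}_{n=0}^\infty$ of continuous self-maps of $X$; write $f_0^n=f_{n-1}\circ\cdots\circ f_0$ for $n\ge1$. $\mathcal{M}(X)$ is the space of all Borel probability measures on $X$ with the Prohorov metric $\mathcal{P}_d(\mu,\nu)=\inf\{\epsilon>0:\mu(A)\le\nu(A^\epsilon)+\epsilon \text{ and } \nu(A)\le\mu(A^\epsilon)+\epsilon \text{ for all Borel } A\subset X\}$, where $A^\epsilon=\{x\in X: d(x,A)<\epsilon\}$; its topology is the weak$^*$-topology and $\mathcal{M}(X)$ is a compact metric space. The induced system $(\mathcal{M}(X),\hat f_{0,\infty})$, $\hat f_{0,\infty}=\{\hat f_n\}_{n=0}^\infty$, consists of the continuous maps $\hat f_n(\mu)(A)=\mu(f_n^{-1}(A))$. For $x\in X$ and $\epsilon,\delta>0$ let $N_d(x,\epsilon,\delta)=\{n\ge1:\text{there exists } y \text{ with } d(x,y)<\epsilon \text{ and } d(f_0^n(x),f_0^n(y))>\delta\}$. $(X,f_{0,\infty})$ is cofinitely sensitive if there is $\delta>0$ such that for all $x\in X$ and $\epsilon>0$ the set $N_d(x,\epsilon,\delta)$ is cofinite, i.e. has finite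 complement in the set $\mathbf{N}$ of nonnegative integers. For $\mathcal{M}(X)$ the metric used is $\mathcal{P}_d$. *)

(* Defs.v *)
From HB Require Import structures.
From mathcomp Require Import all_boot all_order all_algebra.
From mathcomp Require Import all_classical all_reals all_analysis.

Set Implicit Arguments.
Unset Strict Implicit.
Unset Printing Implicit Defensive.

Import Order.TTheory GRing.Theory Num.Theory.
Import numFieldNormedType.Exports.

Local Open Scope classical_set_scope.
Local Open Scope ring_scope.

(* Measurable types are pointed in MathComp-Analysis; [point] carries no
   information beyond the nonemptiness of the space. *)
#[short(type="pointedMetricType")]
HB.structure Definition PointedMetric (K : numDomainType) :=
  {M of Metric K M & Pointed M}.

Section sensitivity.
Context {R : realType} {T : Type}.
Variables (d : T -> T -> R) (f : nat -> T -> T).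

Fixpoint iterate (n : nat) : T -> T :=
  if n is m.+1 then f m \o iterate m else id.

Definition sensitive_times (x : T) (eps delta : R) : set nat :=
  [set n | (1 <= n)%N /\
     exists y, d x y < eps /\ d (iterate n x) (iterate n y) > delta].

(* The complement is taken in [nat]; it always contains 0. *)
Definition cofinitely_sensitive : Prop :=
  exists2 delta : R, 0 < delta &
    forall x eps, 0 < eps -> finite_set (~` sensitive_times x eps delta).

End sensitivity.

Definition borelType {R : realType} (X : pointedMetricType R) :
  measurableType (@open X).-sigma := g_sigma_algebraType (@open X).

Definition borel_probability {R : realType} (X : pointedMetricType R) :=
  probability (borelType X) R.

Section prohorov.
Context {R : realType} {X : pointedMetricType R}.
Implicit Types (A : set X) (mu nu : borel_probability X).

(* The distance from a point to the empty set is +oo, so that the thickening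
   of the empty set is empty. *)
Definition thickening A (eps : R) : set X :=
  [set x | (ereal_inf [set (mdist x a)%:E | a in A] < eps%:E)%E].

Definition prohorov mu nu : R :=
  inf [set eps : R | 0 < eps /\
    forall A : set (borelType X), measurable A ->
      (mu A <= nu (thickening A eps) + eps%:E)%E /\
      (nu A <= mu (thickening A eps) + eps%:E)%E].

End prohorov.

Section induced_map.
Context {R : realType} {X : pointedMetricType R}.
Variables (f : X -> X) (cf : continuous f).

Lemma borel_measurable_continuous :
  measurable_fun [set: borelType X] (f : borelType X -> borelType X).
Proof.
apply: (@measurability _ _ (borelType X) (borelType X) setT f (@open X)) => //.
move=> _ [B oB <-]; rewrite setTI; apply: sub_sigma_algebra.
by move/continuousP : cf; exact.
Qed.

Definition continuous_mfun : {mfun borelType X >-> borelType X} :=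
  mfun_Sub (mem_set borel_measurable_continuous).

Definition induced_map (mu : borel_probability X) : borel_probability X :=
  distribution mu continuous_mfun.

Lemma induced_mapE (mu : borel_probability X) (A : set X) :
  induced_map mu A = mu (f @^-1` A).
Proof. by []. Qed.

End induced_map.

(* Main.v *)
Require Import Defs.
From mathcomp Require Import all_boot all_order all_algebra.
From mathcomp Require Import all_classical all_reals all_analysis.
From mathcomp Require Import lra.

(* Dirac measures transfer sensitivity from M(X) to X: if every point near x
   stays near f^n x at time n, then so does almost all the mass of any measure
   close to the Dirac measure at x.
   Conversely, cover X by K balls of radius delta/4. For a measure mu and a
   time n, some ball B has mass at least 1/K for the n-th image of mu. Cover X
   by finitely many small balls; for all but finitely many n, near each of
   their centers there is a point whose n-th image avoids the c-thickening of
   B, c <= delta/4: either the center itself, or a point that sensitivity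
   separates from it by more than delta. Moving mu onto these points changes it
   by little but empties the c-thickening of B at time n. *)

Import Order.TTheory GRing.Theory Num.Theory.

Local Open Scope classical_set_scope.
Local Open Scope ring_scope.

(** * Balls, thickenings and finite nets *)

Section metric.
Context {R : realType} {X : pointedMetricType R}.
Implicit Types (A : set X) (x y : X) (e : R).

Lemma open_mdist_ball x e : open [set y | mdist x y < e].
Proof.
rewrite openE => y /= xy.
apply/nbhs_ballP; exists (e - mdist x y) => /=; first by rewrite subr_gt0.
move=> z; rewrite ballEmdist /= => yz /=.
by apply: le_lt_trans (metric_triangle x y z) _; lra.
Qed.

Lemma measurable_open A : open A -> measurable (A : set (borelType X)).
Proof. exact: sub_sigma_algebra. Qed.

Lemma thickeningP A e x :
  thickening A e x <-> exists2 a, A a & mdist x a < e.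
Proof.
split=> [/ereal_inf_lt[_ [a Aa <-]]|[a Aa xa]]; first by exists a.
by apply: le_lt_trans (ereal_inf_lbound _) _; first by exists a.
Qed.

Lemma open_thickening A e : open (thickening A e).
Proof.
rewrite (_ : thickening A e = \bigcup_(a in A) [set y | mdist a y < e]).
  by apply: bigcup_open => a _; exact: open_mdist_ball.
apply/seteqP; split=> x.
- by move=> /thickeningP[a Aa]; rewrite metric_sym; exists a.
- by move=> [a Aa /=]; rewrite metric_sym => xa; apply/thickeningP; exists a.
Qed.

Lemma measurable_thickening A e :
  measurable (thickening A e : set (borelType X)).
Proof. exact: measurable_open (open_thickening _ _). Qed.

Lemma thickening_mono A (e1 e2 : R) :
  e1 <= e2 -> thickening A e1 `<=` thickening A e2.
Proof.
move=> e12 x /thickeningP[a Aa xa]; apply/thickeningP.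
by exists a => //; exact: lt_le_trans xa e12.
Qed.

Lemma compact_finite_net e : compact [set: X] -> 0 < e ->
  exists s : seq X, forall x, exists2 z, z \in s & mdist z x < e.
Proof.
rewrite compact_cover => cX e0.
have [|x _|D _ Dcov] := cX X setT (fun z => [set y | mdist z y < e]).
- by move=> z _; exact: open_mdist_ball.
- by exists x; rewrite //= mdistxx.
by exists (finmap.enum_fset D) => x; have [z zD xz] := Dcov x Logic.I; exists z.
Qed.

End metric.

(** * Prohorov estimates, measurable selection and large pieces of a cover *)

Section borel_probabilities.
Context {R : realType} {X : pointedMetricType R}.
Implicit Types (mu nu : borel_probability X) (A : set X) (x : X) (e : R).

Definition prohorov_bound mu nu : set R := [set eps : R | 0 < eps /\
  forall A : set (borelType X), measurable A ->
    (mu A <= nu (thickening A eps) + eps%:E)%E /\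
    (nu A <= mu (thickening A eps) + eps%:E)%E].

Lemma prohorov_le mu nu e : prohorov_bound mu nu e -> prohorov mu nu <= e.
Proof. by apply: ge_inf; exists 0 => x [/ltW]. Qed.

(** Since [inf set0] is 0, a small value of [prohorov] yields an actual bound only once this set is
    known to be nonempty. *)
Lemma prohorov_bound_nonempty mu nu : prohorov_bound mu nu !=set0.
Proof.
exists 1; split=> // A mA.
by split; apply: le_trans (probability_le1 _ mA) _; rewrite leeDr.
Qed.

(** The infimum may not be attained, but the strict inequality gives a bound [e1 < e], and replacing
    [e1] by [e] only enlarges the right-hand side. *)
Lemma prohorov_lt mu nu e : prohorov mu nu < e ->
  forall A, measurable (A : set (borelType X)) ->
  (mu A <= nu (thickening A e) + e%:E)%E.
Proof.
move=> /(inf_lt (prohorov_bound_nonempty mu nu))[e1 [_ mn] e1e] A mA.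
apply: le_trans (mn A mA).1 _; apply: leeD; last by rewrite lee_fin ltW.
apply: le_measure; rewrite ?inE; [exact: measurable_thickening..|].
by apply: thickening_mono; exact: ltW.
Qed.

Lemma iterate_inducedE (f : nat -> X -> X) (cf : forall n, continuous (f n))
    n mu A :
  iterate (fun n => induced_map (cf n)) n mu A = mu (iterate f n @^-1` A).
Proof. by elim: n A => // n IH A; rewrite /= induced_mapE IH. Qed.

Lemma continuous_iterate (f : nat -> X -> X) (cf : forall n, continuous (f n)) n :
  continuous (iterate f n).
Proof.
elim: n => [|n IH] x; first exact: cvg_id.
by apply: continuous_comp; [exact: IH|exact: cf].
Qed.

Lemma measurable_preimage (g : X -> X) A : continuous g -> open A ->
  measurable (g @^-1` A : set (borelType X)).
Proof.
by move=> cg oA; apply: measurable_open; move/continuousP: cg; exact.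
Qed.

Lemma measurable_set1_borel x : measurable ([set x] : set (borelType X)).
Proof.
rewrite -[[set x]]setCK; apply: measurableC; apply: measurable_open.
apply: closed_openC; apply: accessible_closed_set1.
by apply: hausdorff_accessible; exact: metric_hausdorff.
Qed.

(** Test on the singleton of [x]: it has Dirac mass 1 and its thickening is the ball. *)
Lemma prohorov_dirac_lt x mu e :
  prohorov (\d_(x : borelType X)) mu < e ->
  (1 <= mu [set y | mdist x y < e]%R + e%:E)%E.
Proof.
move=> /prohorov_lt/(_ _ (measurable_set1_borel x)).
rewrite /= diracE mem_set // (_ : thickening _ _ = [set y | mdist x y < e]) //.
apply/seteqP; split=> y; first by move=> /thickeningP[_ ->]; rewrite metric_sym.
by move=> /= xy; apply/thickeningP; exists x => //; rewrite metric_sym.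
Qed.

(** [nu] need only take the values of a Dirac measure, so that iterated images of Dirac measures are
    covered. *)
Lemma prohorov_dirac_le x nu mu e : 0 < e ->
  (forall A, nu A = \d_(x : borelType X) A) ->
  (1 <= mu [set y | mdist x y < e]%R + e%:E)%E -> prohorov nu mu <= e.
Proof.
move=> e0 nuE; set B := [set y | _] => muB.
have mB : measurable (B : set (borelType X)).
  exact: measurable_open (open_mdist_ball _ _).
apply: prohorov_le; split=> // A mA; rewrite !nuE !diracE; split.
  have [|xA] := boolP (x \in A); last by rewrite adde_ge0 // lee_fin ltW.
  rewrite inE => xA; apply: le_trans muB _; apply: leeD => //.
  apply: le_measure; rewrite ?inE; [by []|exact: measurable_thickening|].
  move=> y; rewrite /B /= => xy; apply/thickeningP.
  by exists x => //; rewrite metric_sym.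
(* If [A] meets [B], its thickening contains [x]; otherwise [mu A <= 1 - mu B <= e]. *)
have [/eqP AB|/set0P[y [Ay By]]] := boolP (A `&` B == set0); last first.
  rewrite mem_set; last by apply/thickeningP; exists y.
  by apply: le_trans (probability_le1 _ mA) _; rewrite leeDl // lee_fin ltW.
apply: (@le_trans _ _ e%:E); last by rewrite leeDr // lee_fin.
have : (mu A + mu B <= 1)%E.
  by rewrite -measureU //; apply: probability_le1; exact: measurableU.
rewrite -(fineK (fin_num_measure mu _ mA)) -(fineK (fin_num_measure mu _ mB)) in muB *.
by move: muB; rewrite -!EFinD !lee_fin; lra.
Qed.

(** As [g] moves points by less than [e], the thickening of [A] contains the preimage of [A], and
    its own preimage contains [A]. *)
Lemma prohorov_distribution_le mu (g : {mfun borelType X >-> borelType X}) e :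
  0 < e -> (forall x, mdist (x : X) (g x : X) < e) ->
  prohorov mu (distribution mu g) <= e.
Proof.
move=> e0 ge; apply: prohorov_le; split=> // A mA.
have mg (B : set (borelType X)) : measurable B -> measurable (g @^-1` B).
  by move=> mB; rewrite -[_ @^-1` _]setTI; exact: measurable_funP.
have mAe := measurable_thickening A e.
split; (apply: le_trans; last by apply: leeDl; rewrite lee_fin ltW).
- apply: le_measure; rewrite ?inE; [exact: mA|exact: mg|move=> x Ax].
  by apply/thickeningP; exists x => //; rewrite metric_sym.
- apply: (@le_measure _ _ _ mu (g @^-1` A)); rewrite ?inE;
    [exact: mg|exact: mAe|move=> x Agx].
  by apply/thickeningP; exists (g x).
Qed.

(** [g] sends [x] to the point chosen for the first ball of the list containing [x], and to [point]
    if there is none; finitely many case distinctions on open balls keep it measurable. *)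
Lemma measurable_selection (s : seq X) (Q : X -> Prop) e :
  (forall z, z \in s -> exists2 c, Q c & mdist z c < e) ->
  exists2 g : borelType X -> borelType X, measurable_fun setT g &
    forall x : X, (exists2 z, z \in s & mdist z x < e) ->
      Q (g x) /\ mdist x (g x : X) < e + e.
Proof.
elim: s => [_|z s IH Hs]; first by exists (fun=> point) => // x [].
have [c Qc zc] := Hs z (mem_head z s).
have [|g mg gP] := IH.
  by move=> y ys; apply: Hs; rewrite inE ys orbT.
exists (fun x : borelType X => if mdist z (x : X) < e then c else g x).
  apply: measurable_fun_ifT => //; apply: (measurable_fun_bool true).
  by rewrite setTI; exact: measurable_open (open_mdist_ball _ _).
move=> x xs; case: ifPn => [zx|zx].
  split=> //; apply: le_lt_trans (metric_triangle x z c) _.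
  by rewrite metric_sym ltrD.
apply: gP; case: xs => y; rewrite inE => /orP[/eqP ->|]; last by exists y.
by rewrite (negbTE zx).
Qed.

Lemma measure_bigsetU_le (I : choiceType) (s : seq I) (F : I -> set X) mu c :
  (forall i, measurable (F i : set (borelType X))) ->
  (forall i, i \in s -> mu (F i) <= c%:E)%E ->
  (mu (\big[setU/set0]_(i <- s) F i) <= ((size s)%:R * c)%:E)%E.
Proof.
move=> mF; elim: s => [_|i s IH Hs]; first by rewrite big_nil measure0 mul0r.
rewrite big_cons; apply: le_trans (measureU2 _ _ _) _ => //.
  exact: bigsetU_measurable.
rewrite -natr1 mulrDl mul1r EFinD addeC; apply: leeD.
  by apply: Hs; exact: mem_head.
by apply: IH => j js; apply: Hs; rewrite inE js orbT.
Qed.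

(** Union bound: otherwise the total mass 1 would be at most [(size s)%:R * c]. *)
Lemma exists_large_piece (I : choiceType) (s : seq I) (F : I -> set X) mu c :
  (forall i, measurable (F i : set (borelType X))) ->
  (forall x, exists2 i, i \in s & F i x) -> (size s)%:R * c < 1 ->
  exists2 i, i \in s & (c%:E < mu (F i))%E.
Proof.
move=> mF Fs sc; apply: contrapT => noi.
have : (mu (\big[setU/set0]_(i <- s) F i) <= ((size s)%:R * c)%:E)%E.
  apply: measure_bigsetU_le => // i si; rewrite leNgt; apply/negP => ci.
  by apply: noi; exists i.
rewrite (_ : \big[setU/set0]_(i <- s) F i = setT); last first.
  apply/seteqP; split=> // x _; have [i si Fix] := Fs x.
  by rewrite -bigcup_seq; exists i.
by rewrite probability_setT lee_fin leNgt sc.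
Qed.

End borel_probabilities.

(** * The two implications *)

Section sensitivity.
Context {R : realType} {X : pointedMetricType R}.
Variables (f : nat -> X -> X) (cf : forall n, continuous (f n)).

Local Notation fhat := (fun n => induced_map (cf n)).

Lemma cofinitely_sensitive_of_induced :
  cofinitely_sensitive (@prohorov R X) fhat ->
  cofinitely_sensitive (@mdist R X) f.
Proof.
(* Not being far means [<= delta / 2], hence [< delta], as the open ball in [prohorov_dirac_le]
   requires. *)
move=> [delta d0 Hd]; exists (delta / 2); first by lra.
(* The ball of this radius lies in the [e]-ball of [x], and [mu] leaves at most [delta / 2] of its
   mass outside it. *)
move=> x e e0; have e'0 : 0 < Num.min e (delta / 2) by rewrite lt_min e0; lra.
apply: sub_finite_set (Hd (\d_(x : borelType X)) _ e'0); apply: subsetC.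
move=> n [n1 [mu [/prohorov_dirac_lt xmu far]]]; split=> //.
apply: contrapT => near; move: far; rewrite ltNge => /negP; apply.
apply: (@prohorov_dirac_le _ _ (iterate f n x)) => //.
  by move=> A; rewrite iterate_inducedE.
rewrite iterate_inducedE; apply: le_trans xmu _; apply: leeD; last first.
  by rewrite lee_fin ge_min; apply/orP; right; lra.
apply: le_measure; rewrite ?inE.
- exact: measurable_open (open_mdist_ball _ _).
- by apply: measurable_preimage; [exact: continuous_iterate|exact: open_mdist_ball].
move=> y /=; rewrite lt_min => /andP[xy _]; rewrite ltNge; apply/negP => yfar.
by apply: near; exists y; split => //; lra.
Qed.

Lemma induced_cofinitely_sensitive (cX : compact [set: X]) :
  cofinitely_sensitive (@mdist R X) f ->
  cofinitely_sensitive (@prohorov R X) fhat.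
Proof.
move=> [delta d0 Hd].
have d40 : 0 < delta / 4 by lra.
have [s sP] := compact_finite_net _ cX d40.
(* [c] is both a thickening radius and a mass; the successor makes [(size s)%:R * c < 1] strict, so
   some ball has mass above [c]. *)
pose c : R := Num.min (delta / 4) (size s).+1%:R^-1.
have c0 : 0 < c by rewrite lt_min invr_gt0 ltr0n andbT; lra.
have cd : c <= delta / 4 by rewrite ge_min lexx.
have sc : (size s)%:R * c < 1.
  apply: (@le_lt_trans _ _ ((size s)%:R * (size s).+1%:R^-1)).
    by apply: ler_wpM2l => //; rewrite ge_min lexx orbT.
  by rewrite ltr_pdivrMr ?ltr0n // mul1r ltr_nat.
(* A distance [<= c / 2] is [< c], the strict bound that [prohorov_lt] takes. *)
exists (c / 2); first by lra.
move=> mu e e0; have e40 : 0 < e / 4 by lra.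
have [t tP] := compact_finite_net _ cX e40.
(* Adding [point] makes the list visibly nonempty, from which [1 <= n] is read off. *)
apply: (@sub_finite_set _ _ (\bigcup_(z in [set` (point : X) :: t])
    ~` sensitive_times (@mdist R X) f z (e / 4) delta)); last first.
  by apply: bigcup_finite => [|z _]; [exact: finite_seq|exact: Hd].
rewrite -setC_bigcap; apply: subsetC => n nt.
have n1 : (1 <= n)%N by have [] := nt point (mem_head _ _).
split=> //.
pose Ball z : set X := [set y | mdist z y < delta / 4].
pose F z := iterate f n @^-1` Ball z.
have mF z : measurable (F z : set (borelType X)).
  by apply: measurable_preimage; [exact: continuous_iterate|exact: open_mdist_ball].
have [z zs cFz] := @exists_large_piece _ _ _ s F mu c mF (fun x => sP _) sc.
pose B := Ball z.
have [z' z't|g mg gP] := @measurable_selection _ _ t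
    (fun y => ~ thickening B c (iterate f n y)) (e / 4).
  have [_ [y [z'y far]]] : sensitive_times (@mdist R X) f z' (e / 4) delta n.
    by apply: nt; rewrite /= inE z't orbT.
  (* Two points of the [c]-thickening of [B] are less than [2 * (delta / 4 + c) <= delta] apart, so
     the images of [z'] and [y] cannot both lie in it. *)
  have [/thickeningP[a za z'a]|] := pselect (thickening B c (iterate f n z')).
    exists y => // /thickeningP[b zb yb]; move: far za zb; rewrite /B /Ball /=.
    have := metric_triangle (iterate f n z') a (iterate f n y).
    have := metric_triangle a z (iterate f n y).
    have := metric_triangle z b (iterate f n y).
    rewrite (metric_sym a z) (metric_sym b); lra.
  by exists z' => //; rewrite mdistxx.
pose gm : {mfun borelType X >-> borelType X} := mfun_Sub (mem_set mg).
exists (distribution mu gm); split.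
  apply: (@le_lt_trans _ _ (e / 4 + e / 4)); last by lra.
  by apply: prohorov_distribution_le => [|x]; [lra|exact: (gP x (tP x)).2].
rewrite ltNge; apply/negP => close.
(* Testing on [B] would give [mu (F z) <= 0 + c], against the choice of [z]. *)
have : prohorov (iterate fhat n mu) (iterate fhat n (distribution mu gm)) < c.
  by apply: le_lt_trans close _; lra.
move=> /prohorov_lt/(_ B (measurable_open _ (open_mdist_ball _ _))).
rewrite !iterate_inducedE leNgt => /negP; apply.
have gB : g @^-1` (iterate f n @^-1` thickening B c) = set0.
  by apply/seteqP; split=> // x xB; case: (gP x (tP x)).1.
rewrite [X in (X + _)%E](_ : _ = 0%E) ?add0e //.
exact: etrans (congr1 mu gB) (measure0 mu).
Qed.

End sensitivity.

Theorem theorem4p3 (R : realType) (X : pointedMetricType R)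
    (cX : compact [set: X])
    (f : nat -> X -> X) (cf : forall n, continuous (f n)) :
  cofinitely_sensitive (@mdist R X) f <->
  cofinitely_sensitive (@prohorov R X) (fun n => induced_map (cf n)).
Proof.
split; first exact: induced_cofinitely_sensitive.
exact: cofinitely_sensitive_of_induced.
Qed.
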